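(* Let $q$ be a prime power with $q \equiv \pm 3 \pmod 8$, and let $n$ be a positive integer which is not of the form $2^m$ and not of the form $2^m(2^{2k}+1)$ for any non-negative integers $m, k$. Then the group $G = PSp_{2n}(q)$ contains a nonpronormal subgroup of odd index, i.e. there is a subgroup $H \le G$ such that $|G:H|$ is odd and $H$ is not pronormal in $G$.
   Context: For a subgroup $H$ of a group $G$ and $g \in G$, write $H^g = g^{-1}Hg$. A subgroup $H$ of $G$ is called pronormal in $G$ if for every $g \in G$ the subgroups $H$ and $H^g$ are conjugate in $\langle H, H^g\rangle$, i.e. there is $x \in \langle H, H^g\rangle$ with $H^x = H^g$. $PSp_{2n}(q) = Sp_{2n}(q)/Z(Sp_{2n}(q))$ is the projective symplectic group of the $2n$-dimensional symplectic space over the field $\mathbb{F}_q$ with $q$ elements. *)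

(* Defs.v *)
From HB Require Import structures.
From mathcomp Require Import all_boot all_order all_algebra all_fingroup all_solvable.

Set Implicit Arguments.
Unset Strict Implicit.
Unset Printing Implicit Defensive.

Import GroupScope GRing.Theory.

Definition pronormal (gT : finGroupType) (H G : {set gT}) : Prop :=
  forall g, g \in G ->
    exists x, x \in <<H :|: H :^ g>> /\ H :^ x = H :^ g.

Section Symplectic.

Variables (n : nat) (F : finFieldType).

(* Gram matrix, in block form (0, 1; -1, 0) with n x n blocks, of the standard
   nondegenerate alternating form on F^(2n).  The size (2n).-1.+1, which is 2n
   for n > 0, is that of the matrices in {'GL_(2n)[F]}. *)
Definition symp_mx : 'M[F]_n.*2.-1.+1 :=
  (\matrix_(i, j) if (j == i + n :> nat)%N then 1
                  else if (i == j + n :> nat)%N then -1 else 0)%R.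

(* Matrices act on row vectors from the right, so that u |-> u *m g preserves
   the form (u, v) |-> u *m symp_mx *m v^T exactly when the equation holds. *)
Definition Sp : {set {'GL_(n.*2)[F]}} :=
  [set g : {'GL_(n.*2)[F]} |
    GLval g *m symp_mx *m (GLval g)^T == symp_mx]%R.

Lemma Sp_group_set : group_set Sp.
Proof.
apply/group_setP; split; first by rewrite inE GL_1E trmx1 mulmx1 mul1mx.
move=> g h; rewrite !inE => /eqP Hg /eqP Hh.
by rewrite GL_MxE trmx_mul !mulmxA -(mulmxA _ _ symp_mx)
           -(mulmxA _ _ (GLval h)^T)%R Hh Hg.
Qed.

Canonical Sp_group : {group {'GL_(n.*2)[F]}} := Group Sp_group_set.

Definition PSp : {group coset_of 'Z(Sp)} := (Sp / 'Z(Sp))%G.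

End Symplectic.

(* Main.v *)
Require Import Defs.
From HB Require Import structures.
From mathcomp Require Import all_boot all_order all_algebra all_fingroup all_solvable.
From mathcomp Require Import mxabelem.
From mathcomp Require Import ring zify.

(** The form on F^(2n) is an orthogonal sum of n hyperbolic planes, so that
SL_2(F) wr S_n embeds in Sp_2n(F) by block monomial matrices. As q is 3 or 5
modulo 8, a quaternion group Q of order 8 is a Sylow 2-subgroup of SL_2(F); some
x of order 3 normalizes it, A = Q<x> is a copy of SL_2(3), and A / Q gives a
homomorphism chi from A to F_3 that kills Q and maps x to 1
([quaternion_in_Sp1]).

The assumption on n yields n = n1 + n2 with n1 > 0 divisible by 3 and no carry
in the binary addition ([carry_free_multiple_of_3]). Let D be a set of n1 of the
n planes and T its stabilizer in S_n. The subgroup is the image of H = Q wr T in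
the projective group.

Its index is odd: the 2-adic valuation of q^(2i) - 1 is 3 + v_2(i), so the
2-part of the order of Sp_2n(q) is that of 8^n n! ([logn2_card_Sp]), whereas the
order of H is divisible by 8^n n1! n2!; the 2-parts of n! and n1! n2! agree by
the choice of n1 and n2. The order of Sp_2n(q) is obtained in [card_Sp] by choosing
the rows of a symplectic matrix one after the other, from the bottom up.

It is not pronormal ([wreath_quotient_not_pronormal]): modulo Q^n, the group
A wr T becomes the semidirect product of the permutation module V = F_3^n with
T, and H becomes the complement T. Let g be the translation by a basis vector e
of V indexed by a point of D. Both T and T^g lie in the subgroup in which the
sum of the D-coordinates vanishes. If an element of that subgroup conjugated T
to T^g, it would differ from g by an element normalizing T, whose component in V
is constant on each T-orbit; D is such an orbit and its size is divisible by 3,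
so the sum of the D-coordinates of e would vanish, whereas it is 1. Dividing by
the centre of Sp_2n(F) does not affect this: an element normalizing H only modulo
the centre still has constant D-coordinates ([wreath_norm_char_sum0]). *)

Set Implicit Arguments.
Unset Strict Implicit.
Unset Printing Implicit Defensive.

(** * 2-adic valuations and carry-free sums *)

Lemma logn2_odd m : odd m -> logn 2 m = 0.
Proof. by move=> m_odd; rewrite logn_coprime // coprime2n. Qed.

Lemma odd_logn2 m : 0 < m -> odd m = (logn 2 m == 0).
Proof.
by move=> m_gt0; apply: negb_inj; rewrite -dvdn2 -lt0n logn_gt0 mem_primes m_gt0.
Qed.

Lemma logn2_double m : 0 < m -> logn 2 m.*2 = (logn 2 m).+1.
Proof. by move=> m_gt0; rewrite -mul2n lognM // logn_prime. Qed.

(** Lifting the exponent at 2. An odd i gives q^(2i) = 9 modulo 16; doubling i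
multiplies q^(2i) - 1 by q^(2i) + 1, which is twice an odd number. *)
Lemma logn2_expn_sub1 q i : q %% 8 = 3 \/ q %% 8 = 5 -> 0 < i ->
  logn 2 (q ^ i.*2 - 1) = 3 + logn 2 i.
Proof.
move=> q8; have q_sq : q ^ 2 %% 16 = 9.
  have : q %% 16 \in [:: 3; 5; 11; 13] by rewrite !inE; lia.
  by rewrite -modnXm !inE => /or4P[] /eqP->.
elim/ltn_ind: i => i IHi i_gt0; have [i_odd | i_even] := boolP (odd i).
  have powi : q ^ i.*2 %% 16 = 9.
    rewrite -mul2n expnM -modnXm q_sq -(odd_double_half i) i_odd -mul2n.
    by rewrite expnD expnM -modnMmr -modnXm exp1n.
  have [m Em] : exists m, q ^ i.*2 - 1 = 2 ^ 3 * m.*2.+1.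
    by exists (q ^ i.*2 %/ 16); lia.
  by rewrite Em lognM ?expn_gt0 // pfactorK // !logn2_odd //= odd_double.
have Ei : i = i./2.*2 by rewrite -[LHS]odd_double_half (negPf i_even).
have j_gt0 : 0 < i./2 by lia.
have powj : q ^ i %% 8 = 1.
  rewrite Ei -mul2n expnM -modnXm.
  have -> : q ^ 2 %% 8 = 1 by lia.
  by rewrite exp1n.
have q_gt0 : 1 < q ^ i.
  by rewrite -(exp1n i) ltn_exp2r //; lia.
have -> : q ^ i.*2 - 1 = (q ^ i - 1) * (q ^ i + 1).
  by rewrite -muln2 expnM expnS expn1; nia.
rewrite lognM ?subn_gt0 ?addn_gt0 ?orbT // {1 3}Ei IHi //; last by lia.
have [m Em] : exists m, q ^ i + 1 = 2 * m.*2.+1.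
  by exists (q ^ i %/ 4); lia.
rewrite Em mul2n logn2_double // [logn 2 m.*2.+1]logn2_odd /= ?odd_double //.
by rewrite logn2_double //; lia.
Qed.

Lemma logn_prod_nat p n (f : nat -> nat) : (forall i, i < n -> 0 < f i) ->
  logn p (\prod_(0 <= i < n) f i) = \sum_(0 <= i < n) logn p (f i).
Proof.
elim: n => [|n IHn] f_gt0; first by rewrite !big_geq // logn1.
rewrite !big_nat_recr //= lognM ?f_gt0 // ?IHn // => [i lti|].
  by rewrite f_gt0 // ltnW.
by rewrite big_mkord prodn_gt0 // => i; rewrite f_gt0 // ltnW // ltnS ltn_ord.
Qed.

Definition v2fact n := logn 2 n`!.

Lemma v2factS n : v2fact n.+1 = logn 2 n.+1 + v2fact n.
Proof. by rewrite /v2fact factS lognM ?fact_gt0. Qed.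

Lemma v2fact_sum n : \sum_(0 <= i < n) logn 2 (n - i) = v2fact n.
Proof.
elim: n => [|n IHn]; first by rewrite big_geq.
by rewrite big_nat_recl // subn0 v2factS -IHn; congr (_ + _); apply: eq_bigr.
Qed.

Lemma v2fact_double n : v2fact n.*2 = n + v2fact n.
Proof.
elim: n => // n IHn; rewrite doubleS !v2factS IHn.
rewrite [logn 2 n.*2.+1]logn2_odd /= ?odd_double //.
rewrite -doubleS logn2_double //; lia.
Qed.

Lemma v2fact_doubleS n : v2fact n.*2.+1 = n + v2fact n.
Proof. by rewrite v2factS v2fact_double logn2_odd //= odd_double. Qed.

(** No carry occurs when the two powers of 2 in this sum are added in base 2,
so by Kummer's theorem their binomial coefficient is odd. *)
Lemma v2fact_carry_free a m : 0 < m ->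
  v2fact (2 ^ a * (2 ^ m + 1)) = v2fact (2 ^ a) + v2fact (2 ^ (a + m)).
Proof.
case: m => // m _; elim: a => [|a IHa].
  rewrite expn0 mul1n add0n expnS mul2n addn1 v2fact_doubleS v2fact_double.
  by rewrite [v2fact 1]logn1.
rewrite addSn (expnS 2 a) (expnS 2 (a + m.+1)) -mulnA !mul2n.
rewrite !v2fact_double IHa mulnDr -expnD; lia.
Qed.

(** Powers of 2 are 1 or 2 modulo 3 according to the parity of the exponent.
Hence two binary digits of n whose positions have different parities, or three
whose positions have the same parity, add up to a multiple of 3. The last case
below, in which the valuations say that n1 + n2 is added without carry, thus
covers every n except 0, the powers of 2, and the sums of two powers of 2 whose
exponents have the same parity. The induction removes the lowest binary digit
of n. *)
Lemma carry_free_multiple_of_3 n :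
  [\/ n = 0, exists m, n = 2 ^ m, exists m k, n = 2 ^ m * (2 ^ (2 * k) + 1)
    | exists n1 n2, [/\ n = n1 + n2, 0 < n1, 3 %| n1
                      & v2fact n = v2fact n1 + v2fact n2]].
Proof.
have modpow k : 2 ^ (2 * k) %% 3 = 1 by rewrite expnM -modnXm /= exp1n.
elim/ltn_ind: n => -[|n] IHn; first by constructor 1.
have all_n : 3 %| n.+1 -> exists n1 n2, [/\ n.+1 = n1 + n2, 0 < n1, 3 %| n1
                      & v2fact n.+1 = v2fact n1 + v2fact n2].
  by exists n.+1, 0; rewrite addn0 [v2fact 0]logn1 addn0.
set h := n.+1./2; have Eh := odd_double_half n.+1; rewrite -/h in Eh.
have lth : h < n.+1 by rewrite /h; lia.
have [o | o] := boolP (odd n.+1); last first.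
  have {}Eh : n.+1 = h.*2 by rewrite -Eh (negPf o).
  have [h0 | [m Em] | [m [k Em]] | [n1 [n2 [En n1_gt0 n1_3 v_n]]]] := IHn _ lth.
  - by rewrite h0 in Eh.
  - by constructor 2; exists m.+1; rewrite Eh Em expnS mul2n.
  - by constructor 3; exists m.+1, k; rewrite Eh Em expnS -mulnA -[LHS]mul2n.
  constructor 4; exists n1.*2, n2.*2.
  rewrite Eh !v2fact_double v_n En; split; lia.
have {}Eh : n.+1 = h.*2.+1 by rewrite -Eh o.
have pow m : n.+1 = 2 ^ m.+1 + 1 ->
    (exists m k, n.+1 = 2 ^ m * (2 ^ (2 * k) + 1)) \/ 3 %| n.+1.
  move=> En; have [m_odd | m_even] := boolP (odd m.+1).
    right; rewrite En -(odd_double_half m.+1) m_odd expnS -mul2n.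
    by have := modpow m.+1./2; lia.
  left; exists 0, m.+1./2; rewrite mul1n mul2n En; congr (2 ^ _ + 1).
  by rewrite -[LHS]odd_double_half (negPf m_even).
have [h0 | [m Em] | [m [k Em]] | [n1 [n2 [En n1_gt0 n1_3 v_n]]]] := IHn _ lth.
- by constructor 2; exists 0; rewrite Eh h0.
- case: (pow m) => [||/all_n]; [|by constructor 3|by constructor 4].
  by rewrite Eh Em expnS mul2n addn1.
- have En : n.+1 = 2 ^ m.+1 * (2 ^ (2 * k) + 1) + 1.
    by rewrite Eh Em expnS -mulnA -mul2n [RHS]addn1.
  have [k0 | k_gt0] := posnP k.
    case: (pow m.+1) => [||/all_n]; [|by constructor 3|by constructor 4].
    by rewrite En k0 muln0 expn0 (expnS 2 m.+1) mulnC.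
  (* The digits of n sit at 0, m + 1 and m + 1 + 2k: all three have the same
     parity, or else the lowest two have different ones. *)
  constructor 4; have [m_odd | m_even] := boolP (odd m.+1); last first.
    apply: all_n; rewrite En; have := modpow k; have := modpow m.+1./2.
    have -> : (2 * m.+1./2) = m.+1 by lia.
    move=> E1 E2; rewrite /dvdn -modnDml -modnMm.
    by rewrite -[(2 ^ (2 * k) + 1) %% 3]modnDml E1 E2.
  exists (2 ^ m.+1 + 1), (2 ^ (m.+1 + 2 * k)); split.
  + by rewrite En mulnDr -expnD; lia.
  + by rewrite addn1.
  + rewrite -(odd_double_half m.+1) m_odd expnS -mul2n.
    by have := modpow m.+1./2; lia.
  rewrite Eh v2fact_doubleS addSn !expnS !(mul2n (2 ^ _)) addn1.
  rewrite v2fact_doubleS v2fact_double.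
  by rewrite Em v2fact_carry_free ?muln_gt0 // mulnDr -expnD; lia.
constructor 4; exists n1.*2, n2.*2.+1.
rewrite Eh !v2fact_doubleS v2fact_double v_n En; split; lia.
Qed.

Import GroupScope GRing.Theory.

(** * Wreath products *)

Section Wreath.

Variables (I : finType) (gT : finGroupType).

(** The wreath product of gT with the symmetric group on I. In a product the
left permutation reindexes the right function, which is the rule by which block
monomial matrices multiply. *)
Definition wreath := ({ffun I -> gT} * {perm I})%type.

HB.instance Definition _ := Finite.on wreath.

Implicit Types u v w : wreath.

Definition wreath_mul u v : wreath :=
  ([ffun i => u.1 i * v.1 (u.2 i)], u.2 * v.2).
Definition wreath_one : wreath := ([ffun=> 1], 1).
Definition wreath_top (t : {perm I}) : wreath := ([ffun=> 1], t).
Definition wreath_inv u : wreath := ([ffun i => (u.1 (u.2^-1 i))^-1], u.2^-1).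

Fact wreath_mulA : associative wreath_mul.
Proof.
move=> u v w; congr (_, _); last exact: mulgA.
by apply/ffunP=> i; rewrite !ffunE mulgA permM.
Qed.

Fact wreath_mul1 : left_id wreath_one wreath_mul.
Proof.
case=> a s; congr (_, _); last exact: mul1g.
by apply/ffunP=> i; rewrite !ffunE mul1g perm1.
Qed.

Fact wreath_mulV : left_inverse wreath_one wreath_inv wreath_mul.
Proof.
move=> u; congr (_, _); last exact: mulVg.
by apply/ffunP=> i; rewrite !ffunE mulVg.
Qed.

HB.instance Definition _ :=
  Finite_isGroup.Build wreath wreath_mulA wreath_mul1 wreath_mulV.

Lemma wreathM_fun u v i : (u * v).1 i = u.1 i * v.1 (u.2 i).
Proof. exact: ffunE. Qed.

Lemma wreathM_perm u v : (u * v).2 = u.2 * v.2.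
Proof. by []. Qed.

Lemma wreath1_fun i : (1 : wreath).1 i = 1.
Proof. exact: ffunE. Qed.

Definition wreath_group (B : {set gT}) (T : {set {perm I}}) : {set wreath} :=
  [set w : wreath | [forall i, w.1 i \in B] && (w.2 \in T)].

Lemma in_wreath (B : {set gT}) (T : {set {perm I}}) w :
  reflect ((forall i, w.1 i \in B) /\ w.2 \in T) (w \in wreath_group B T).
Proof. by rewrite inE; apply: (iffP andP) => -[/forallP hB hT]. Qed.

Lemma wreath_group_set (B : {group gT}) (T : {group {perm I}}) :
  group_set (wreath_group B T).
Proof.
apply/group_setP; split=> [|u v /in_wreath[uB uT] /in_wreath[vB vT]].
  by apply/in_wreath; split=> [i|]; rewrite ?wreath1_fun group1.
by apply/in_wreath; split=> [i|]; rewrite ?wreathM_fun ?wreathM_perm groupM.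
Qed.

Canonical wreath_grp B T := Group (wreath_group_set B T).

Lemma card_wreath_group (B : {set gT}) (T : {set {perm I}}) :
  #|wreath_group B T| = (#|B| ^ #|I| * #|T|)%N.
Proof.
transitivity #|setX [set a : {ffun I -> gT} in ffun_on (mem B)] T|.
  by apply: eq_card => -[a s]; rewrite !inE.
by rewrite cardsX cardsE card_ffun_on.
Qed.

End Wreath.

(** * A nonpronormal subgroup of a wreath product *)

Section NonPronormal.

Variables (I : finType) (gT rT : finGroupType) (D : {set I}).
Variables (A Q : {group gT}) (chi : gT -> 'F_3) (x : gT) (G : {group rT}).
Variable f : {morphism [set: wreath I gT] >-> rT}.

Hypothesis D3 : (3 %| #|D|)%N.
Hypothesis D_gt0 : (0 < #|D|)%N.
Hypothesis sQA : Q \subset A.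
Hypothesis chiM : {in A &, forall a b, chi (a * b) = (chi a + chi b)%R}.
Hypothesis chiQ : {in Q, forall a, chi a = 0%R}.
Hypothesis Ax : x \in A.
Hypothesis chix : chi x = 1%R.
Hypothesis injf : 'injm f.

Local Notation T := 'N(D | 'P).

Hypothesis sfG : f @* wreath_group A T \subset G.

(** Through chi, A wr T maps to the semidirect product of T with the permutation
module over 'F_3; this is the sum of the D-coordinates in that module. *)
Definition char_sum (u : wreath I gT) : 'F_3 := (\sum_(i in D) chi (u.1 i))%R.

Definition ker_char_sum := [set w in wreath_group A T | char_sum w == 0%R].

Lemma stab_mem (s : {perm I}) i : s \in T -> (s i \in D) = (i \in D).
Proof. by move=> Ts; have := astabs_act i Ts. Qed.

Lemma char_sumM (u v : wreath I gT) :
  u \in wreath_group A T -> v \in wreath_group A T ->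
  char_sum (u * v) = (char_sum u + char_sum v)%R.
Proof.
move=> /in_wreath[uA uT] /in_wreath[vA vT].
rewrite [char_sum v](reindex_inj (@perm_inj _ u.2)) /=.
rewrite [X in (_ + X)%R](eq_bigl (mem D)); last by move=> i; rewrite /= stab_mem.
by rewrite -big_split /=; apply: eq_bigr => i _; rewrite wreathM_fun chiM.
Qed.

Lemma in_ker_char_sum w :
  (w \in ker_char_sum) = (w \in wreath_group A T) && (char_sum w == 0%R).
Proof. by rewrite inE. Qed.

Lemma char_sum0 (u : wreath I gT) :
  u \in wreath_group Q T -> (char_sum u = 0)%R.
Proof. by case/in_wreath=> uQ _; rewrite /char_sum big1 // => i _; rewrite chiQ. Qed.

Fact ker_char_sum_group_set : group_set ker_char_sum.
Proof.
apply/group_setP; split=> [|u v].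
  by rewrite in_ker_char_sum group1 char_sum0 ?group1 ?eqxx.
rewrite !in_ker_char_sum => /andP[hu /eqP su] /andP[hv /eqP sv].
by rewrite char_sumM ?su ?sv ?addr0 ?groupM //= eqxx.
Qed.

Canonical ker_char_sum_group := Group ker_char_sum_group_set.

Lemma third_point i j : i \in D -> j \in D ->
  exists k, [/\ k \in D, k != i & k != j].
Proof.
move=> Di Dj; have: (0 < #|D :\ i :\ j|)%N.
  have: (2 < #|D|)%N by rewrite dvdn_leq.
  rewrite (cardsD1 i D) (cardsD1 j (D :\ i)) Di addnA.
  by case: (j \in _); case: #|_|.
case/card_gt0P=> k; rewrite !inE => /and3P[kj ki kD].
by exists k.
Qed.

Lemma tperm_stab i j : i \in D -> j \in D -> tperm i j \in T.
Proof.
move=> Di Dj; apply/astabsP=> k; rewrite /= /aperm.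
by case: tpermP => // ->; rewrite Di Dj.
Qed.

Lemma central_wreath_const (w : wreath I gT) :
    (forall v, v \in wreath_group A T -> commute w v) ->
  {in D &, forall i j, w.1 i = w.1 j}.
Proof.
move=> cw i j Di Dj.
have /cw/(congr1 (fun v : wreath I gT => v.1 i)):
    wreath_top gT (tperm i j) \in wreath_group A T.
  by apply/in_wreath; split=> [l|]; rewrite ?ffunE ?group1 ?tperm_stab.
by rewrite !wreathM_fun /= !ffunE tpermL mulg1 mul1g.
Qed.

(** Let u normalize Q wr T up to elements w centralizing A wr T. Comparing
coordinates for the transposition t of two points i, j of D shows that
chi (u.1 (t l)) - chi (u.1 l) is the same value chi (w.1 i) for all l in D.
A third point of D is fixed by t, so this value is 0; hence chi (u.1 _) is
constant on D, and its sum over D is a multiple of #|D|. *)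
Lemma wreath_norm_char_sum0 (u : wreath I gT) :
    u \in wreath_group A T ->
    (forall t, t \in T -> exists h w,
       [/\ h \in wreath_group Q T, w \in wreath_group A T,
           forall v, v \in wreath_group A T -> commute w v
         & wreath_top gT t * u = u * (h * w)]) ->
  (char_sum u = 0)%R.
Proof.
move=> /in_wreath[uA uT] normu.
have chi_const: {in D &, forall i j, chi (u.1 i) = chi (u.1 j)}.
  move=> i j Di Dj.
  have [h [w [/in_wreath[hQ hT] /in_wreath[wA wT] cw E]]] :=
    normu _ (tperm_stab Di Dj).
  have chiE l : l \in D ->
      (chi (u.1 (tperm i j l)) = chi (u.1 l) + chi (w.1 i))%R.
    move=> Dl; have := congr1 (fun v : wreath I gT => chi (v.1 l)) E.
    rewrite !wreathM_fun /= ffunE mul1g => ->.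
    have hA m : h.1 m \in A by apply: (subsetP sQA).
    rewrite !chiM ?groupM // (chiQ (hQ _)) add0r; congr (_ + chi _)%R.
    by apply: (central_wreath_const cw) => //; rewrite !stab_mem.
  have [k [Dk ki kj]] := third_point Di Dj.
  have w0: (chi (w.1 i) = 0)%R.
    apply: (addrI (chi (u.1 k))); rewrite addr0 -chiE // tpermD // eq_sym //.
  by have := chiE _ Di; rewrite tpermL w0 addr0.
have /card_gt0P[i0 Di0] := D_gt0.
rewrite /char_sum (eq_bigr (fun=> chi (u.1 i0))) => [|i Di]; last exact: chi_const.
rewrite sumr_const -mulr_natr; case/dvdnP: D3 => m ->.
by rewrite natrM (_ : 3%:R = 0 :> 'F_3)%R ?mulr0 //; apply/val_inj.
Qed.

(** Take for g the element x placed at one point of D. Both Q wr T and its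
conjugate by g lie in the kernel of char_sum, so an element k conjugating one to
the other inside the group that they generate has char_sum k = 0. Then
u = k g^-1 normalizes Q wr T modulo the centre, hence char_sum u = 0; but
char_sum g = 1. *)
Lemma wreath_quotient_not_pronormal :
  ~ pronormal (f @* wreath_group Q T / 'Z(G)) (G / 'Z(G)).
Proof.
move=> pron.
have /card_gt0P[i0 Di0] := D_gt0.
pose g : wreath I gT := ([ffun i => if i == i0 then x else 1], 1).
have Wg : g \in wreath_group A T.
  apply/in_wreath; split=> [i|]; last exact: group1.
  by rewrite ffunE; case: ifP.
have sumg : (char_sum g = 1)%R.
  rewrite /char_sum (bigD1 i0) //= big1 => [|i /andP[_ /negPf ne]].
    by rewrite addr0 ffunE eqxx.
  by rewrite ffunE ne chiQ.
have sQW : wreath_group Q T \subset wreath_group A T.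
  apply/subsetP=> w /in_wreath[wQ wT]; apply/in_wreath; split=> // i.
  exact: (subsetP sQA).
have Gf w : w \in wreath_group A T -> f w \in G.
  by move=> Ww; apply/(subsetP sfG)/mem_morphim; rewrite ?in_setT.
have sHG : f @* wreath_group Q T \subset G.
  by apply: subset_trans sfG; apply: morphimS.
have nZG : G \subset 'N('Z(G)) by rewrite gFnorm.
have [xb []] := pron _ (mem_quotient 'Z(G) (Gf _ Wg)).
rewrite -quotientJ ?(subsetP nZG) ?Gf //.
rewrite -quotientU -quotient_gen; last first.
  rewrite (subset_trans _ nZG) // subUset sHG.
  by rewrite -(conjGid (Gf _ Wg)) conjSg.
rewrite -morphimJ ?in_setT // -morphimU -morphim_gen ?subsetT //.
case/morphimP=> _ _ /morphimP[k _ Kk ->] -> {xb}.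
have {}Kk : k \in ker_char_sum_group.
  apply: subsetP Kk; rewrite gen_subG subUset; apply/andP.
  have sQK: wreath_group Q T \subset ker_char_sum_group.
    apply/subsetP=> w Qw.
    by rewrite in_ker_char_sum (subsetP sQW) ?char_sum0 ?eqxx.
  split=> //; apply/subsetP=> _ /imsetP[w Qw ->].
  have Ww : w \in wreath_group A T by apply: (subsetP sQW).
  change (w ^ g \in ker_char_sum); rewrite in_ker_char_sum groupJ //=.
  rewrite conjgE !char_sumM ?groupM ?groupV //.
  have := char_sumM (groupVr Wg) Wg; rewrite mulVg (char_sum0 (group1 _)) sumg.
  move/esym/eqP; rewrite addr_eq0 => /eqP->.
  by rewrite char_sum0 // add0r addrN.
move=> eqHk; set u := k * g^-1.
have [Wk sumk]: k \in wreath_group A T /\ (char_sum k = 0)%R.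
  by move: Kk; rewrite in_ker_char_sum => /andP[? /eqP].
have Wu : u \in wreath_group A T by rewrite groupM ?groupV.
suff sumu : (char_sum u = 0)%R.
  have := char_sumM Wu Wg; rewrite mulgKV sumk sumu sumg add0r.
  by move/(congr1 val).
apply: wreath_norm_char_sum0 => // t Tt; set s := wreath_top gT t.
have Qs : s \in wreath_group Q T.
  by apply/in_wreath; split=> // i; rewrite ffunE group1.
have Ws : s \in wreath_group A T by apply: (subsetP sQW).
have nZf w : w \in wreath_group A T -> f w \in 'N('Z(G)).
  by move/Gf; apply: (subsetP nZG).
(* Lift to the wreath product the fact that the image of s ^ k modulo the centre
   lies in that of the conjugate of Q wr T by g. *)
have: coset 'Z(G) (f (s ^ k)) \in f @* (wreath_group Q T :^ g) / 'Z(G).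
  rewrite -eqHk morphJ ?in_setT // morphJ ?nZf //= memJ_conjg.
  by rewrite mem_quotient ?mem_morphim ?in_setT.
case/morphimP=> z _ /morphimP[_ _ /imsetP[h Qh ->] ->{z}] eq_coset.
have Wh : h \in wreath_group A T by apply: (subsetP sQW).
have [w Ew] : exists w, w = (h ^ g)^-1 * s ^ k by eexists.
have Ww : w \in wreath_group A T by rewrite Ew groupM ?groupV ?groupJ.
have Zw : f w \in 'Z(G).
  apply: coset_idr; first exact: nZf.
  rewrite Ew morphM ?in_setT // morphV ?in_setT //.
  rewrite morphM ?groupV ?nZf ?groupJ // morphV ?nZf ?groupJ //=.
  by rewrite eq_coset mulVg.
have cw v : v \in wreath_group A T -> commute w v.
  move=> Wv; apply: (injmP injf); rewrite ?in_setT //.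
  rewrite (morphM f (x := w)) ?(morphM f (x := v)) ?in_setT //.
  exact/esym/(centerC (Gf _ Wv) Zw).
exists h, w; split=> //.
have -> : h * w = g * ((h ^ g) * w) * g^-1.
  by rewrite mulgA conjgE !mulgA mulgV mul1g -!mulgA (cw g^-1) ?groupV // mulKVg.
by rewrite Ew mulKVg conjgE /u !mulgA mulgKV mulgV mul1g.
Qed.

End NonPronormal.

(** * Block monomial symplectic matrices *)

Section Blocks.

Variables (m : nat) (F : finFieldType).
Local Notation n := m.+1.
Local Notation N := (n.*2.-1.+1).
Local Notation p := (1.*2.-1.+1).

Local Open Scope ring_scope.

(** The index i + c * n of F^(2n) is side c of the i-th hyperbolic pair. *)
Definition pair_of (k : 'I_N) : 'I_n := inord (if k < n then k : nat else k - n)%N.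
Definition side_of (k : 'I_N) : 'I_p := inord (n <= k)%N.
Definition pair_index (i : 'I_n) (c : 'I_p) : 'I_N := inord (i + c * n)%N.

Lemma pair_indexE i c : pair_index i c = (i + c * n)%N :> nat.
Proof.
rewrite inordK //; case: i c => i lt_i [[|[|c]] lt_c] //=; lia.
Qed.

Lemma pair_of_index i c : pair_of (pair_index i c) = i.
Proof.
apply: val_inj; rewrite /pair_of /side_of pair_indexE.
case: i c => i lt_i [[|[|c]] lt_c] //=.
  by rewrite mul0n addn0 lt_i inordK.
by rewrite mul1n ltnNge leq_addl addnK /= inordK.
Qed.

Lemma side_of_index i c : side_of (pair_index i c) = c.
Proof.
apply: val_inj; rewrite /pair_of /side_of pair_indexE.
case: i c => i lt_i [[|[|c]] lt_c] //=.
  by rewrite mul0n addn0 leqNgt lt_i inordK.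
by rewrite mul1n leq_addl inordK.
Qed.

Lemma pair_indexK k : pair_index (pair_of k) (side_of k) = k.
Proof.
apply: ord_inj; rewrite pair_indexE /side_of /pair_of.
have := ltn_ord k; rewrite /= => lt_k.
by case: ltnP => ?; rewrite !inordK ?mul0n ?mul1n //; lia.
Qed.

Lemma sum_pair_side (R : nmodType) (E : 'I_n -> 'I_p -> R) :
  \sum_(k < N) E (pair_of k) (side_of k) = \sum_i \sum_c E i c.
Proof.
rewrite pair_bigA (reindex (fun q : 'I_n * 'I_p => pair_index q.1 q.2)) /=.
  by apply: eq_bigr => -[i c] _; rewrite pair_of_index side_of_index.
apply: onW_bij; exists (fun k => (pair_of k, side_of k)) => [[i c] | k] /=.
  by rewrite pair_of_index side_of_index.
exact: pair_indexK.
Qed.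

(** In the basis ordered by hyperbolic pairs, this is the matrix made of the
2 x 2 blocks a i at the places (i, s i). *)
Definition block_monomial (a : 'I_n -> 'M[F]_p) (s : {perm 'I_n}) : 'M[F]_N :=
  \matrix_(k, l) if pair_of l == s (pair_of k)
                 then a (pair_of k) (side_of k) (side_of l) else 0.

Lemma block_monomialM a b s t :
  block_monomial a s *m block_monomial b t =
  block_monomial (fun i => a i *m b (s i)) (s * t)%g.
Proof.
apply/matrixP=> k l; rewrite !mxE permM.
under eq_bigr do rewrite !mxE.
rewrite (sum_pair_side (fun i c =>
  (if i == s (pair_of k) then a (pair_of k) (side_of k) c else 0) *
  (if pair_of l == t i then b i c (side_of l) else 0))) /=.
rewrite (bigD1 (s (pair_of k))) //= [X in _ + X]big1 ?addr0 => [|i /negPf ne].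
  rewrite eqxx; case: eqP => _ //.
  by rewrite big1 // => c _; rewrite mulr0.
by rewrite ne big1 // => c _; rewrite mul0r.
Qed.

Lemma block_monomial1 : block_monomial (fun=> 1%:M) 1 = 1%:M.
Proof.
apply/matrixP=> k l; rewrite !mxE perm1 [pair_of l == _]eq_sym.
case: (k =P l) => [-> | ne]; first by rewrite !eqxx.
case: eqP => // eq_p; case: eqP => // eq_s.
by case: ne; rewrite -(pair_indexK k) -(pair_indexK l) eq_p eq_s.
Qed.

Lemma block_monomial_tr a s :
  (block_monomial a s)^T = block_monomial (fun i => (a (s^-1%g i))^T) s^-1.
Proof.
apply/matrixP=> k l; rewrite !mxE [pair_of l == _]eq_sym.
rewrite (can2_eq (permKV s) (permK s)).
by case: eqP => // ->; rewrite permK.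
Qed.

(** F^(2n) is the orthogonal sum of n hyperbolic planes. *)
Lemma symp_block : symp_mx n F = block_monomial (fun=> symp_mx 1 F) 1.
Proof.
apply/matrixP=> k l; rewrite !mxE perm1.
rewrite -[in LHS](pair_indexK k) -[in LHS](pair_indexK l) !pair_indexE.
case: (pair_of k) (side_of k) (pair_of l) (side_of l).
move=> i lt_i [c lt_c] [j lt_j] [d lt_d] /=.
rewrite -val_eqE /=.
case: c d lt_c lt_d => [|[|]] // [|[|]] //= _ _.
all: rewrite ?mul0n ?mul1n ?addn0 ?addn1 /=.
all: repeat case: eqP => ? //; exfalso; lia.
Qed.

Lemma eq_block_monomial a b s : a =1 b -> block_monomial a s = block_monomial b s.
Proof. by move=> eq_ab; apply/matrixP=> k l; rewrite !mxE eq_ab. Qed.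

End Blocks.

Section Symplectic.

Variable (F : finFieldType).
Local Open Scope ring_scope.

Lemma symp1_mulT : symp_mx 1 F *m (symp_mx 1 F)^T = 1%:M.
Proof.
apply/matrixP=> k l; rewrite !mxE !big_ord_recl big_ord0 !mxE /=.
case: k l => [[|[|k]] lt_k] [[|[|l]] lt_l] //=.
all: by rewrite ?mulr0 ?mul0r ?mulr1 ?mulrNN ?mulr1 ?addr0 ?add0r.
Qed.

Lemma symp_mulT n : (0 < n)%N -> symp_mx n F *m (symp_mx n F)^T = 1%:M.
Proof.
case: n => // n _; rewrite symp_block block_monomial_tr invg1 block_monomialM mulg1.
rewrite -block_monomial1; apply: eq_block_monomial => i.
exact: symp1_mulT.
Qed.

Lemma symp_preserving_unit n (M : 'M[F]_n.*2.-1.+1) : (0 < n)%N ->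
  M *m symp_mx n F *m M^T = symp_mx n F -> M \in unitmx.
Proof.
move=> n_gt0 MJM; have := symp_mulT n_gt0; rewrite -{1}MJM -!mulmxA.
by case/mulmx1_unit.
Qed.

Lemma symp_preserving_Sp n (M : 'M[F]_n.*2.-1.+1) : (0 < n)%N ->
  M *m symp_mx n F *m M^T = symp_mx n F -> exists2 g, g \in Sp n F & GLval g = M.
Proof.
move=> n_gt0 MJM; have uM := symp_preserving_unit n_gt0 MJM.
by exists (FinRing.Unit uM : {'GL_(n.*2)[F]}); rewrite // inE; apply/eqP.
Qed.

Section Embedding.

Variable m : nat.
Local Notation n := m.+1.
Local Notation gT := {'GL_(1.*2)[F]}.

Definition wreath_mx (w : wreath 'I_n gT) : 'M[F]_n.*2.-1.+1 :=
  block_monomial (fun i => GLval (w.1 i)) w.2.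

Lemma wreath_mxM u v : wreath_mx (u * v)%g = wreath_mx u *m wreath_mx v.
Proof.
rewrite /wreath_mx block_monomialM wreathM_perm; apply: eq_block_monomial => i.
by rewrite wreathM_fun.
Qed.

Lemma wreath_mx1 : wreath_mx 1%g = 1%:M.
Proof.
rewrite -block_monomial1; apply: eq_block_monomial => i.
by rewrite wreath1_fun.
Qed.

Fact wreath_mx_unit w : wreath_mx w \in unitmx.
Proof.
have := wreath_mxM w w^-1; rewrite mulgV wreath_mx1 => /esym.
by case/mulmx1_unit.
Qed.

Definition wreath_GL w : {'GL_(n.*2)[F]} := FinRing.Unit (wreath_mx_unit w).

Fact wreath_GLM : {in [set: wreath 'I_n gT] &, {morph wreath_GL : u v / (u * v)%g}}.
Proof. by move=> u v _ _; apply: val_inj; apply: wreath_mxM. Qed.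

Canonical wreath_GL_morphism := Morphism wreath_GLM.

Lemma injm_wreath_GL : 'injm wreath_GL.
Proof.
apply/subsetP=> w /morphpreP[_ /set1P/(congr1 GLval) w1].
have {}w1 k l := congr1 (fun M : 'M[F]_n.*2.-1.+1 => M k l) w1.
have w1E i j c d : (if j == w.2 i then GLval (w.1 i) c d else 0) =
    ((i == j) && (c == d))%:R :> F.
  have := w1 (pair_index i c) (pair_index j d).
  rewrite !mxE !pair_of_index !side_of_index => ->.
  congr (nat_of_bool _)%:R; apply/eqP/andP=> [E | [/eqP-> /eqP->] //].
  move: (congr1 (@pair_of m) E) (congr1 (@side_of m) E).
  by rewrite !pair_of_index !side_of_index => -> ->.
have s1 : w.2 = 1%g.
  apply/permP=> i; rewrite perm1; apply/esym/eqP.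
  have := w1E i i 0 0; rewrite !eqxx; case: eqP => // _ /esym/eqP.
  by rewrite oner_eq0.
apply/set1P; rewrite [w]surjective_pairing s1; congr (_, _); apply/ffunP=> i.
rewrite ffunE; apply: val_inj; apply/matrixP=> c d.
by have := w1E i i c d; rewrite s1 perm1 !eqxx /= => ->; rewrite [RHS]mxE.
Qed.

Lemma wreath_GL_Sp (A : {set gT}) T :
  A \subset Sp 1 F -> wreath_GL @* wreath_group A T \subset Sp n F.
Proof.
move=> sASp; apply/subsetP=> _ /morphimP[w _ /in_wreath[wA _] ->].
rewrite inE /= /wreath_mx symp_block block_monomialM block_monomial_tr.
rewrite block_monomialM mulg1 mulgV; apply/eqP/eq_block_monomial => i.
rewrite permK.
by have := subsetP sASp _ (wA i); rewrite inE => /eqP.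
Qed.

End Embedding.

End Symplectic.

(** * The group SL_2(3) inside SL_2(F) *)

(** The quotient of Q<x> by Q is cyclic of order 3, and chi is the discrete
logarithm to the base of the coset of x. *)
Lemma cubic_character (gT : finGroupType) (Q : {group gT}) (x : gT) :
    x \in 'N(Q) -> #[x] = 3 -> ~~ (3 %| #|Q|)%N ->
  exists chi : gT -> 'F_3,
    [/\ {in Q <*> <[x]> &, forall a b, chi (a * b) = (chi a + chi b)%R},
        {in Q, forall a, chi a = 0%R} & chi x = 1%R].
Proof.
move=> nQx ox Q3; set y := coset Q x.
have oy : #[y] = 3.
  apply: nt_prime_order => //; first by rewrite -morphX // -ox expg_order morph1.
  apply: contraNneq Q3 => /(coset_idr nQx) Qx.
  by rewrite -ox orderE cardSg // cycle_subG.
pose chi a : 'F_3 := if [pick k : 'I_3 | coset Q a == y ^+ k] is Some k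
                     then (nat_of_ord k)%:R%R else 0%R.
have chiE a m : coset Q a = y ^+ m -> chi a = m%:R%R.
  rewrite /chi => ->; case: pickP => [k | /(_ (inord (m %% 3)))/=].
    rewrite eq_expg_mod_order oy => /eqP m_k.
    by rewrite -(@Fp_nat_mod 3) // -m_k Fp_nat_mod.
  by rewrite inordK ?ltn_mod // -{1}(expg_mod_order y m) oy eqxx.
have chi_ex a : a \in Q <*> <[x]> -> exists2 m, a \in 'N(Q) & coset Q a = y ^+ m.
  have sN : Q <*> <[x]> \subset 'N(Q) by rewrite join_subG normG cycle_subG.
  move=> Aa; have := mem_quotient Q Aa.
  rewrite quotientYidl ?cycle_subG // quotient_cycle // => /cycleP[m ->].
  by exists m => //; apply: (subsetP sN).
exists chi; split=> [a b /chi_ex[k Na ak] /chi_ex[l Nb bl] | a Qa | ].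
- rewrite (chiE a k) // (chiE b l) // (chiE _ (k + l)%N) ?natrD //.
  by rewrite morphM //= ak bl expgD.
- by rewrite (chiE a 0%N) // coset_id.
- by rewrite (chiE x 1%N).
Qed.

(** The relations make <i, j> a quaternion group of order 8 and let x permute
i, i j, j cyclically, as in SL_2(3). As <i, j> is a 2-group, x of order 3 lies
outside it. *)
Lemma quaternion_relations (gT : finGroupType) (i j x : gT) :
    i ^+ 2 = j ^+ 2 -> i ^+ 4 = 1 -> i ^+ 2 != 1 -> i ^ j = i^-1 ->
    x ^+ 3 = 1 -> i ^ x = i * j -> j ^ x = i ->
  exists chi : gT -> 'F_3,
    [/\ (8 %| #|<[i]> <*> <[j]>|)%N,
        {in <[i]> <*> <[j]> <*> <[x]> &,
           forall a b, chi (a * b) = (chi a + chi b)%R},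
        {in <[i]> <*> <[j]>, forall a, chi a = 0%R} & chi x = 1%R].
Proof.
move=> i2 i4 ni2 ij x3 ix jx; set Q := <[i]> <*> <[j]>.
have o4 a : a ^+ 2 = i ^+ 2 -> #[a] = 4.
  move=> a2; rewrite (@orderXprime _ 2 2) // a2.
  by apply: nt_prime_order; rewrite // -expgM.
have [oi oj] : #[i] = 4 /\ #[j] = 4 by rewrite !o4.
have nij : j \in 'N(<[i]>).
  by rewrite -cycle_subG cycle_subG; apply/normP; rewrite -cycleJ ij cycleV.
have cardQ : (#|Q| * #|<[i]> :&: <[j]>| = 16)%N.
  rewrite /Q norm_joinEr ?cycle_subG // -mul_cardG -!orderE oi oj //.
have i_notin_j : i \notin <[j]>.
  apply: contra ni2 => /cycleP[k Ek]; have : i ^ j = i.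
    by rewrite {1}Ek conjXg conjgE mulKg -Ek.
  by rewrite ij expgS expg1 => /eqP; rewrite eq_invg_mul.
have Q8 : (8 %| #|Q|)%N.
  have : (#|<[i]> :&: <[j]>| %| 2)%N.
    have : (#|<[i]> :&: <[j]>| %| 4)%N by rewrite -oi cardSg ?subsetIl.
    have : #|<[i]> :&: <[j]>| != 4.
      apply: contra i_notin_j => /eqP I4; rewrite -cycle_subG.
      by apply/setIidPl/eqP; rewrite eqEcard subsetIl I4 -orderE oi.
    by case: #|_| => [|[|[|[|[|n]]]]] // _ /dvdn_leq.
  case/dvdnP=> k Ek; rewrite -(@dvdn_pmul2r #|<[i]> :&: <[j]>|) ?cardG_gt0 //.
  by rewrite cardQ; apply/dvdnP; exists k; rewrite mulnCA -Ek.
have Q3 : ~~ (3 %| #|Q|)%N.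
  by apply/negP=> Q3; have := dvdn_mulr #|<[i]> :&: <[j]>| Q3; rewrite cardQ.
have nQx : x \in 'N(Q).
  rewrite inE {1}/Q joingE -genJ gen_subG conjUg -!cycleJ subUset !cycle_subG.
  by rewrite ix jx groupM // mem_gen // inE cycle_id ?orbT.
have ox : #[x] = 3.
  apply: nt_prime_order => //; apply: contraNneq i_notin_j => x1.
  by rewrite -jx x1 conjg1 cycle_id.
have [chi [chiM chiQ chix]] := cubic_character nQx ox Q3.
by exists chi.
Qed.

Section QuaternionInSp.

Variable F : finFieldType.
Hypothesis F_odd : odd #|F|.
Local Open Scope ring_scope.

Lemma two_neq0 : 2%:R != 0 :> F.
Proof.
pose G := [set: F]%G.
apply: contraL F_odd => /eqP two0.
have /(cardSg)/= : (<[1%R : F]> \subset G)%g by apply: subsetT.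
rewrite cardsT -orderE.
suff -> : #[1%R : F]%g = 2%N by rewrite dvdn2 => ->.
apply: nt_prime_order => //; last exact: oner_neq0.
Qed.

(** Pigeonhole: a^2 and -1 - b^2 each take at least #|F| / 2 values, and #|F| is
odd, so the two sets of values meet. *)
Lemma sum_two_squares_m1 : exists a b : F, a ^+ 2 + b ^+ 2 = -1.
Proof.
pose S := [set a ^+ 2 | a : F]; pose S' := [set - 1 - b ^+ 2 | b : F].
have cardS' : #|S'| = #|S|.
  have -> : S' = [set - 1 - c | c in S].
    apply/setP=> c; apply/imsetP/imsetP=> [[b _ ->] | [_ /imsetP[b _ ->] ->]].
      by exists (b ^+ 2) => //; apply/imsetP; exists b.
    by exists b.
  by apply: card_imset => x y /addrI/oppr_inj.
have leF : (#|F| <= #|S| * 2)%N.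
  rewrite -cardsT -sum1_card.
  rewrite (partition_big (fun a => a ^+ 2) (mem S)) => [|a _]; last exact: imset_f.
  rewrite -sum_nat_const; apply: leq_sum => c /imsetP[a _ ->].
  rewrite sum1_card; apply: (@leq_trans #|[set a; - a]|).
    apply/subset_leq_card/subsetP=> b; rewrite !inE.
    by case/andP=> _; rewrite eqf_sqr.
  by rewrite cards2 ltnS leq_b1.
have [disj | [c /setIP[/imsetP[a _ ->] /imsetP[b _ Eab]]]] := set_0Vmem (S :&: S').
  have : (#|S| * 2 <= #|F|)%N.
    by rewrite muln2 -addnn -{2}cardS' -cardsUI disj cards0 addn0 max_card.
  move=> geF; have /eqP cardF: #|F| == (#|S| * 2)%N by rewrite eqn_leq leF.
  by move: F_odd; rewrite cardF muln2 odd_double.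
by exists a, b; rewrite Eab subrK.
Qed.

Definition mx2 (a b c d : F) : 'M[F]_(1.*2.-1.+1) :=
  \matrix_(k, l) if k == 0 then (if l == 0 then a else b)
                 else (if l == 0 then c else d).

Lemma mx2M a b c d a' b' c' d' :
  mx2 a b c d *m mx2 a' b' c' d' =
  mx2 (a * a' + b * c') (a * b' + b * d') (c * a' + d * c') (c * b' + d * d').
Proof.
apply/matrixP=> k l; rewrite !mxE !big_ord_recl big_ord0 !mxE /=.
by case: k l => [[|[|k]] lt_k] [[|[|l]] lt_l] //=; rewrite addr0.
Qed.

Lemma mx2_eq a b c d a' b' c' d' :
  a = a' -> b = b' -> c = c' -> d = d' -> mx2 a b c d = mx2 a' b' c' d'.
Proof. by move=> -> -> -> ->. Qed.

Lemma mx2_1 : mx2 1 0 0 1 = 1%:M.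
Proof.
by apply/matrixP=> [[[|[|k]] lt_k] [[|[|l]] lt_l]]; rewrite !mxE.
Qed.

Lemma mx2_symp : mx2 0 1 (-1) 0 = symp_mx 1 F.
Proof.
by apply/matrixP=> [[[|[|k]] lt_k] [[|[|l]] lt_l]]; rewrite !mxE.
Qed.

Lemma mx2_Sp a b c d :
  a * d - b * c = 1 -> exists2 g, g \in Sp 1 F & GLval g = mx2 a b c d.
Proof.
move=> det1; apply: symp_preserving_Sp => //.
have -> : (mx2 a b c d)^T = mx2 a c b d.
  by apply/matrixP=> [[[|[|k]] lt_k] [[|[|l]] lt_l]]; rewrite !mxE.
have {}det1 : a * d = 1 + b * c by rewrite -det1 subrK.
by rewrite -mx2_symp !mx2M; apply: mx2_eq; ring: det1.
Qed.

(** With a^2 + b^2 = -1, the matrices i = (0, 1; -1, 0) and j = (a, b; b, -a)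
generate a quaternion group, and x = - (1 + i + j + i j) / 2, a Hurwitz unit of
order 3, permutes i, i j and j cyclically. *)
Lemma quaternion_in_Sp1 :
  exists (A Q : {group {'GL_(1.*2)[F]}}) (x : {'GL_(1.*2)[F]})
         (chi : {'GL_(1.*2)[F]} -> 'F_3),
    [/\ A \subset Sp 1 F, Q \subset A, x \in A, (8 %| #|Q|)%N &
    [/\ {in A &, forall a b, chi (a * b)%g = chi a + chi b},
        {in Q, forall a, chi a = 0} & chi x = 1]].
Proof.
have [a [b abE]] := sum_two_squares_m1.
have ab : b ^+ 2 = - 1 - a ^+ 2 by rewrite -abE addrAC subrr add0r.
pose h : F := 2%:R^-1.
have h2 : h * 2%:R = 1 by rewrite mulVf ?two_neq0.
have [i Spi iE] : exists2 g, g \in Sp 1 F & GLval g = mx2 0 1 (-1) 0.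
  by apply: mx2_Sp; ring.
have [j Spj jE] : exists2 g, g \in Sp 1 F & GLval g = mx2 a b b (- a).
  by apply: mx2_Sp; ring: ab.
have [x Spx xE] : exists2 g, g \in Sp 1 F & GLval g =
    mx2 (- h * (1 + a + b)) (- h * (1 + b - a))
        (- h * (- 1 + b - a)) (- h * (1 - a - b)).
  (* Writing 1 as a power of 2 h makes the identity homogeneous in h, hence
     a polynomial consequence of the relation ab. *)
  have h4 : (h * 2%:R) ^+ 2 = 1 by rewrite h2 expr1n.
  by apply: mx2_Sp; rewrite -[RHS]h4; ring: ab.
have i2E : GLval (i ^+ 2)%g = mx2 (-1) 0 0 (-1).
  by rewrite expgS expg1 GL_MxE iE mx2M; apply: mx2_eq; ring.
have [|||||||chi [Q8 chiM chiQ chix]] := @quaternion_relations _ i j x.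
- by apply: val_inj; rewrite [LHS]i2E !expgS expg0 mulg1 [RHS]GL_MxE jE mx2M;
    apply: mx2_eq; ring: ab.
- apply: val_inj; rewrite (_ : 4 = 2 + 2)%N // expgD [LHS]GL_MxE i2E mx2M.
  apply: etrans mx2_1.
  by apply: mx2_eq; ring.
- apply/eqP=> /(congr1 GLval); rewrite i2E => i2_1.
  have := etrans i2_1 (esym mx2_1) => /matrixP/(_ 0 0); rewrite !mxE /= => /eqP.
  by rewrite eq_sym -addr_eq0; apply/negP/two_neq0.
- have E : (i * (j * i) = j)%g.
    by apply: val_inj; rewrite [LHS]GL_MxE GL_MxE iE [RHS]jE jE !mx2M;
      apply: mx2_eq; ring.
  have E' : (i * j = j * i^-1)%g by rewrite -{2}E mulgA mulgK.
  by rewrite conjgE E' mulKg.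
- have h8 : (h * 2%:R) ^+ 3 = 1 by rewrite h2 expr1n.
  apply: val_inj; rewrite !expgS expg0 mulg1 [LHS]GL_MxE GL_MxE xE !mx2M.
  apply: etrans mx2_1.
  by apply: mx2_eq; rewrite -?[RHS]h8; ring: ab.
- have E : (i * x = x * (i * j))%g.
    by apply: val_inj; rewrite [LHS]GL_MxE [RHS]GL_MxE ?GL_MxE iE ?jE xE !mx2M;
      apply: mx2_eq; ring: ab.
  by rewrite conjgE E mulKg.
- have E : (j * x = x * i)%g.
    by apply: val_inj; rewrite [LHS]GL_MxE [RHS]GL_MxE ?GL_MxE iE ?jE xE !mx2M;
      apply: mx2_eq; ring: ab.
  by rewrite conjgE E mulKg.
exists (<[i]> <*> <[j]> <*> <[x]>)%G, (<[i]> <*> <[j]>)%G, x, chi; split=> //.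
- by rewrite !join_subG !cycle_subG Spi Spj Spx.
- exact: joing_subl.
- by rewrite -cycle_subG joing_subr.
Qed.

End QuaternionInSp.

(** * The order of the symplectic group *)

Section Frames.

Variable F : finFieldType.
Local Open Scope ring_scope.

Lemma card_linear_system N p (B : 'M[F]_(N, p)) (r : 'rV_p) :
  row_full B -> #|[set w : 'rV_N | w *m B == r]| = (#|F| ^ (N - p))%N.
Proof.
move=> fullB; have /submxP[w0 ->] := submx_full r fullB.
have -> : [set w | w *m B == w0 *m B] = [set w0 + w | w in rowg (kermx B)].
  apply/setP=> w; rewrite inE; apply/eqP/imsetP=> [E | [v]].
    exists (w - w0); last by rewrite addrC subrK.
    by rewrite inE sub_kermx mulmxBl E subrr.
  by rewrite inE => /sub_kermxP v0 ->; rewrite mulmxDl v0 addr0.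
rewrite card_imset; last exact: addrI.
by rewrite card_rowg mxrank_ker; move/eqP: fullB => ->.
Qed.

Lemma row_free_col_mx N p (w : 'rV[F]_N) (A : 'M_(p, N)) :
  row_free (col_mx w A) = row_free A && ~~ (w <= A)%MS.
Proof.
rewrite /row_free -addsmxE; have [wA | wA] := boolP (w <= A)%MS.
  rewrite andbF (addsmx_idPr wA) ltn_eqF // ltnS rank_leq_row //.
rewrite andbT -[RHS](eqn_add2l 1); congr (_ == _).
apply/eqP; rewrite -(eqn_add2r (\rank (w :&: A)%MS)) mxrank_sum_cap.
have r1 : \rank w = 1%N.
  rewrite rank_rV; case: eqP wA => // ->; by rewrite sub0mx.
have -> : \rank (w :&: A)%MS = 0%N; last by rewrite r1 addn0.
apply/eqP; apply: contraNT wA; rewrite -lt0n => cap_gt0.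
apply: submx_trans (capmxSr w A); rewrite -(geq_leqif (mxrank_leqif_sup (capmxSl w A))).
by rewrite r1.
Qed.

Variable n : nat.
Hypothesis n_gt0 : (0 < n)%N.
Hypothesis F_odd : odd #|F|.
Local Notation N := (n.*2.-1.+1).
Local Notation S := (symp_mx n F).

Definition symp_entry (a b : nat) : F :=
  if (b == a + n)%N then 1 else if (a == b + n)%N then -1 else 0.

Definition symp_gram p : 'M[F]_p :=
  \matrix_(i, j) symp_entry (N - p + i) (N - p + j).

(** The possible blocks of last p rows of a symplectic matrix. Counting from
the bottom lets a new row be put on top, where 1 + p is convertible to p.+1. *)
Definition symp_frames p : {set 'M[F]_(p, N)} :=
  [set A | row_free A && (A *m S *m A^T == symp_gram p)].

Lemma symp_entryN a b : symp_entry b a = - symp_entry a b.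
Proof.
rewrite /symp_entry.
by repeat case: eqP => ?; rewrite ?opprK ?oppr0 //; exfalso; lia.
Qed.

Lemma symp_trN : S^T = - S.
Proof. by apply/matrixP=> i j; rewrite !mxE; apply: symp_entryN. Qed.

Lemma symp_alternating (w : 'rV[F]_N) : w *m S *m w^T = 0.
Proof.
apply/matrixP=> i j; rewrite !ord1 [RHS]mxE.
have /matrixP/(_ 0 0) : (w *m S *m w^T)^T = - (w *m S *m w^T).
  by rewrite !trmx_mul trmxK symp_trN mulNmx mulmxN mulmxA.
rewrite mxE [RHS]mxE => /eqP; rewrite -addr_eq0 -mulr2n -mulr_natl mulf_eq0.
by rewrite (negPf (two_neq0 F_odd)) => /eqP.
Qed.

Definition new_row p : 'rV[F]_p := \row_j symp_entry (N - p.+1) (N - p + j).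

Lemma symp_gramS p : (p < N)%N ->
  symp_gram p.+1 =
  block_mx 0 (new_row p) (- (new_row p)^T) (symp_gram p) :> 'M_(1 + p).
Proof.
move=> ltp; apply/matrixP=> i j; rewrite -[i]splitK -[j]splitK.
case: (split i) (split j) => {}i [] {}j;
  rewrite ?block_mxEul ?block_mxEur ?block_mxEdl ?block_mxEdr !mxE /=.
- by rewrite !ord1 /symp_entry !ifN //; apply/eqP; lia.
- by rewrite ord1 addn0; congr symp_entry; lia.
- by rewrite -symp_entryN ord1 addn0; congr symp_entry; lia.
- by congr symp_entry; lia.
Qed.

Lemma symp_frames_col_mx p (w : 'rV_N) (A : 'M_(p, N)) : (p < N)%N ->
  (col_mx w A : 'M_(p.+1, N)) \in symp_frames p.+1 =
  [&& A \in symp_frames p, w *m (S *m A^T) == new_row p & ~~ (w <= A)%MS].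
Proof.
move=> ltp; rewrite !inE [row_free _]row_free_col_mx.
rewrite symp_gramS //.
have -> : col_mx w A *m S *m (col_mx w A)^T =
    block_mx 0 (w *m (S *m A^T)) (- (w *m (S *m A^T))^T) (A *m S *m A^T).
  rewrite mul_col_mx tr_col_mx mul_col_row symp_alternating mulmxA.
  by rewrite !trmx_mul trmxK symp_trN mulNmx mulmxN opprK mulmxA.
case: (row_free A) => //=; rewrite [LHS]andbC andbA; congr (_ && _).
apply/eqP/andP=> [E | [/eqP-> /eqP->] //].
by case: (@eq_block_mx _ 1 p 1 p _ _ _ _ _ _ _ _ E) => _ -> _ ->.
Qed.

Lemma new_row_0 p : (p < n)%N -> new_row p = 0.
Proof.
move=> ltp; apply/rowP=> j; rewrite !mxE /symp_entry; have := ltn_ord j.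
by move=> ?; rewrite !ifN //; apply/eqP; lia.
Qed.

Lemma symp_gram_0 p : (p <= n)%N -> symp_gram p = 0.
Proof.
move=> ltp; apply/matrixP=> i j; rewrite !mxE /symp_entry.
have := ltn_ord j; have := ltn_ord i.
by move=> ? ?; rewrite !ifN //; apply/eqP; lia.
Qed.

(** Once p >= n, the row to be added pairs nontrivially with the row n places
below it, which has index n.-1 among the last p and is orthogonal to all of
them. *)
Lemma new_row_independent p (w : 'rV_N) (A : 'M_(p, N)) : (n <= p < N)%N ->
  A \in symp_frames p -> w *m (S *m A^T) = new_row p -> ~~ (w <= A)%MS.
Proof.
case/andP=> lep ltp; rewrite inE => /andP[_ /eqP gramA] Ew.
apply/negP=> /submxP[c wE].
have ltj : (n.-1 < p)%N by lia.
have /rowP/(_ (Ordinal ltj)) := Ew.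
rewrite wE -mulmxA [A *m _]mulmxA gramA !mxE big1 => [|i _].
  rewrite /symp_entry; case: eqP => [_ /esym/eqP | /= ?]; last by exfalso; lia.
  by rewrite oner_eq0.
rewrite mxE /symp_entry /=; have := ltn_ord i.
by move=> ?; rewrite !ifN ?mulr0 //; apply/eqP; lia.
Qed.

(** The prescribed products are p independent linear conditions on the new row.
While p < n the frame is totally isotropic and its whole span satisfies them, so
it must be removed; afterwards independence is automatic. *)
Lemma card_extensions p (A : 'M_(p, N)) : (p < N)%N -> A \in symp_frames p ->
  #|[set w : 'rV_N | (w *m (S *m A^T) == new_row p) && ~~ (w <= A)%MS]| =
  (if (p < n)%N then #|F| ^ (N - p) - #|F| ^ p else #|F| ^ (N - p))%N.
Proof.
move=> ltp frA; have := frA; rewrite inE => /andP[freeA /eqP gramA].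
have fullB : row_full (S *m A^T).
  have [uS _] := mulmx1_unit (symp_mulT F n_gt0).
  rewrite /row_full -mxrank_tr trmx_mul trmxK mxrankMfree ?row_free_unit ?unitmx_tr //.
case: ifP => [ltpn | /negbT]; last first.
  rewrite -leqNgt => lenp; rewrite -(card_linear_system (new_row p) fullB).
  apply: eq_card => w; rewrite !inE; apply: andb_idr => /eqP Ew.
  by apply: new_row_independent frA Ew; rewrite lenp.
rewrite -(card_linear_system (new_row p) fullB).
have -> : (#|F| ^ p = #|rowg A|)%N by rewrite card_rowg (eqP freeA).
rewrite -cardsDS; last first.
  apply/subsetP=> w; rewrite !inE => /submxP[c ->].
  by rewrite -mulmxA [A *m _]mulmxA gramA symp_gram_0 ?mulmx0 ?new_row_0 // ltnW.
by apply: eq_card => w; rewrite !inE andbC.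
Qed.

Lemma card_symp_framesS p : (p < N)%N ->
  #|symp_frames p.+1| =
  (#|symp_frames p| *
   if p < n then #|F| ^ (N - p) - #|F| ^ p else #|F| ^ (N - p))%N.
Proof.
move=> ltp.
pose E (A : 'M_(p, N)) :=
  [set w : 'rV_N | (w *m (S *m A^T) == new_row p) && ~~ (w <= A)%MS].
pose P := [set x : 'M_(p, N) * 'rV_N | (x.1 \in symp_frames p) && (x.2 \in E x.1)].
have -> : symp_frames p.+1 = [set (@col_mx F 1 p N x.2 x.1 : 'M_(p.+1, N)) | x in P].
  apply/setP=> B; rewrite -[B](@vsubmxK _ 1 p) symp_frames_col_mx //.
  apply/idP/imsetP=> [frB | [[A w]]].
    by exists (@dsubmx _ 1 p _ B, @usubmx _ 1 p _ B); rewrite // !inE /= in frB *.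
  rewrite [_ \in P]inE /= => /andP[frA]; rewrite inE => Ew eqB.
  case: (@eq_col_mx _ 1 p _ _ _ _ _ eqB) => -> ->.
  by rewrite frA.
rewrite card_in_imset => [|[A w] [A' w'] _ _ E']; last first.
  by case: (@eq_col_mx _ 1 p _ _ _ _ _ E') => /= -> ->.
rewrite -sum1_card.
rewrite (eq_bigl (fun x => (x.1 \in symp_frames p) && (x.2 \in E x.1))); last first.
  by move=> x; rewrite inE.
rewrite -(pair_big_dep (mem (symp_frames p)) (fun A w => w \in E A)
            (fun _ _ => 1%N)) /=.
under eq_bigr => A frA do rewrite sum1_card card_extensions //.
by rewrite sum_nat_const.
Qed.

Lemma card_Sp : #|Sp n F| =
  (\prod_(0 <= p < N)
     (if p < n then #|F| ^ (N - p) - #|F| ^ p else #|F| ^ (N - p)))%N.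
Proof.
have -> : #|Sp n F| = #|symp_frames N|.
  have <- : [set GLval g | g in Sp n F] = symp_frames N.
    have gramN : symp_gram N = S.
      by apply/matrixP=> i j; rewrite !mxE /symp_entry subnn !add0n.
    apply/setP=> A; rewrite inE gramN row_free_unit.
    apply/imsetP/andP=> [[g] | [uA /eqP]].
      by rewrite inE => Spg ->; rewrite Spg GL_unitmx.
    by case/(symp_preserving_Sp n_gt0)=> g Spg <-; exists g.
  by rewrite card_imset //; apply: val_inj.
have frames_le k : (k <= N)%N -> #|symp_frames k| = (#|symp_frames 0| *
   \prod_(0 <= p < k)
      (if p < n then #|F| ^ (N - p) - #|F| ^ p else #|F| ^ (N - p)))%N.
  elim: k => [|p IHp] ltp; first by rewrite big_geq ?muln1.
  by rewrite card_symp_framesS // IHp ?(ltnW ltp) // big_nat_recr //= mulnA.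
rewrite frames_le //.
suff -> : symp_frames 0 = [set: 'M_(0, N)].
  by rewrite cardsT card_mx mul0n expn0 mul1n.
apply/setP=> A; rewrite !inE /row_free [A]flatmx0 mxrank0 eqxx /=.
by apply/eqP/matrixP; case.
Qed.

End Frames.

(** Only the differences q^(2n-p) - q^p, p < n, in the order of Sp are even, and
each of them is q^p (q^(2(n-p)) - 1), of valuation 3 + v_2(n - p). *)
Lemma logn2_card_Sp (F : finFieldType) n :
    #|F| %% 8 = 3 \/ #|F| %% 8 = 5 -> (0 < n)%N ->
  logn 2 #|Sp n F| = (3 * n + v2fact n)%N.
Proof.
move=> q8 n_gt0; have q_odd : odd #|F| by lia.
have q_gt1 : (1 < #|F|)%N by lia.
have NE : (n.*2.-1.+1 = n.*2)%N by rewrite prednK // double_gt0.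
have v2q e : logn 2 (#|F| ^ e)%N = 0%N by rewrite logn2_odd // oddX q_odd orbT.
have factor_gt0 p : (p < n)%N -> (0 < #|F| ^ (n.*2 - p) - #|F| ^ p)%N.
  by move=> ltpn; rewrite subn_gt0 ltn_exp2l //; lia.
have le_n2n : (n <= n.*2)%N by rewrite -addnn leq_addr.
rewrite card_Sp // NE (big_cat_nat (n := n)) //=.
have prod_gt0 a b : (0 < \prod_(a <= p < b)
    (if p < n then #|F| ^ (n.*2 - p) - #|F| ^ p else #|F| ^ (n.*2 - p)))%N.
  apply: prodn_gt0 => p; case: ifP => [/factor_gt0 // | _].
  by rewrite expn_gt0 ltnW.
rewrite lognM //.
rewrite logn_prod_nat => [|p ltpn]; last by rewrite ltpn factor_gt0.
rewrite [X in (_ + X)%N](_ : _ = 0%N) ?addn0; last first.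
  apply: logn2_odd; rewrite big_nat_cond; apply: (big_ind odd) => // [x y ox oy|p].
    by rewrite oddM ox.
  by case/andP=> /andP[lenp _] _; rewrite ltnNge lenp /= oddX q_odd orbT.
rewrite -v2fact_sum mulnC -[n in (n * 3)%N]subn0 -sum_nat_const_nat -big_split /=.
apply: eq_big_nat => p /andP[_ ltpn]; rewrite ltpn.
have -> : (#|F| ^ (n.*2 - p) - #|F| ^ p = #|F| ^ p * (#|F| ^ (n - p).*2 - 1))%N.
  by rewrite mulnBr muln1 -expnD; congr (_ ^ _ - _)%N; lia.
rewrite lognM ?v2q ?expn_gt0 ?(ltnW q_gt1) ?logn2_expn_sub1 ?subn_gt0 //.
by rewrite -(expn0 #|F|) ltn_exp2l // double_gt0 subn_gt0.
Qed.

(** * Nonpronormal subgroups of odd index *)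

(** The stabilizer contains the direct product of the symmetric groups on D and
on its complement. *)
Lemma fact_dvdn_card_stab (I : finType) (D : {set I}) :
  (#|D|`! * #|~: D|`! %| #|'N(D | 'P)|)%N.
Proof.
have sDT (E : {set I}) : E = D \/ E = ~: D -> perm.Sym E \subset 'N(D | 'P).
  move=> ED; apply/subsetP=> s; rewrite inE => sE.
  apply/astabsP=> i; rewrite /= /aperm.
  have := perm_closed i sE; case: ED => -> //; rewrite !inE.
  exact: negb_inj.
have tiS : perm.Sym D :&: perm.Sym (~: D) = 1.
  apply/trivgP/subsetP=> s; rewrite !inE => /andP[sD sD'].
  apply/eqP/permP=> i; rewrite perm1.
  have [Di | Di] := boolP (i \in D); last exact: out_perm sD Di.
  by apply: (out_perm sD'); rewrite inE Di.
have cS : perm.Sym (~: D) \subset 'C(perm.Sym D).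
  apply/centsP=> s sD' t tD; rewrite !inE in sD' tD.
  by apply: perm_onC sD' tD _; rewrite disjoint_sym disjoints_subset setCK.
rewrite -!perm.card_Sym -(TI_cardMg tiS) -(cent_joinEr cS) cardSg //.
by rewrite join_subG !sDT; [| right | left].
Qed.

Theorem theorem1 (q : nat)
    (hq : exists p k : nat, prime p /\ (0 < k)%N /\ q = (p ^ k)%N)
    (hq8 : q = 3 %[mod 8] \/ q = 5 %[mod 8])
    (F : finFieldType) (hF : #|F| = q)
    (n : nat) (hn : (0 < n)%N)
    (hn1 : ~ exists m : nat, n = (2 ^ m)%N)
    (hn2 : ~ exists m k : nat, n = (2 ^ m * (2 ^ (2 * k) + 1))%N) :
  exists H : {group coset_of 'Z(Sp n F)%g},
    [/\ H \subset PSp n F, odd #|PSp n F : H|%g & ~ pronormal H (PSp n F)].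
Proof.
subst q; have F_odd : odd #|F| by lia.
case: (carry_free_multiple_of_3 n) => [n0 | // | // | [n1 [n2 [En n1_gt0 n1_3 v_n]]]].
  by rewrite n0 in hn.
case: n hn En v_n {hn1 hn2} => // m hn En v_n.
pose D := [set i : 'I_m.+1 | (i < n1)%N].
have cardD : #|D| = n1.
  have le_n1 : (n1 <= m.+1)%N by rewrite En leq_addr.
  have -> : D = widen_ord le_n1 @: 'I_n1.
    apply/setP=> i; rewrite inE; apply/idP/imsetP=> [lti | [j _ ->]]; last exact: ltn_ord j.
    by exists (Ordinal lti) => //; apply: val_inj.
  rewrite card_imset ?card_ord // => i j /(congr1 val) /= eq_ij.
  exact: val_inj.
have cardD' : #|~: D| = n2 by have := cardsC D; rewrite cardD card_ord; lia.
have [A [Q [x [chi [sASp sQA Ax Q8 [chiM chiQ chix]]]]]] := quaternion_in_Sp1 F_odd.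
pose f := wreath_GL_morphism F m.
pose T := 'N(D | 'P).
have sfSp : f @* wreath_group A T \subset Sp m.+1 F by apply: wreath_GL_Sp.
have sHSp : f @* wreath_group Q T \subset Sp m.+1 F.
  by apply: wreath_GL_Sp (subset_trans sQA sASp).
exists (f @* wreath_group Q T / 'Z(Sp m.+1 F))%G; split.
- exact: quotientS.
(* The 2-parts are 8^n n1! n2! at least for the subgroup, and 8^n n! for Sp;
   they agree because n1 + n2 is added without carry. *)
- apply: (@dvdn_odd _ #|Sp m.+1 F : f @* wreath_group Q T|).
    by apply: index_morphim; rewrite subIset // gFnorm.
  rewrite odd_logn2 // -divgS // logn_div ?cardSg // subn_eq0.
  rewrite logn2_card_Sp // card_injm ?subsetT ?injm_wreath_GL //.
  rewrite card_wreath_group card_ord lognM ?expn_gt0 ?cardG_gt0 // lognX mulnC.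
  rewrite leq_add ?leq_mul //; first by rewrite -(pfactor_dvdn 3).
  apply: leq_trans (dvdn_leq_log 2 _ (fact_dvdn_card_stab D)); rewrite ?cardG_gt0 //.
  by rewrite lognM ?fact_gt0 // cardD cardD' v_n.
apply: (wreath_quotient_not_pronormal _ _ sQA chiM chiQ Ax chix) => //.
- by rewrite cardD.
- by rewrite cardD.
- exact: injm_wreath_GL.
Qed.
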